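(* Let $\alpha\in\mathbb{C}_p\setminus\{0\}$ and $\lambda\in T(\alpha)$. If $|\alpha|_p\le1$, then $|\alpha^d+\lambda|_p<1$. If $|\alpha|_p>1$, then $|\lambda|_p>1$.
   Context: Let $p$ be a prime and $d\ge2$ an integer. $\mathbb{C}_p$ is the completion of $\overline{\mathbb{Q}_p}$ with $p$-adic absolute value $|\cdot|_p$, $|p|_p=\frac1p$. For $\lambda\in\mathbb{C}_p$, $f_\lambda(z)=\frac{z^d+\lambda}{pz}$ acting on $\mathbb{P}^1(\mathbb{C}_p)$, and $T(\alpha)=\{\lambda\in\mathbb{C}_p:\alpha\text{ is preperiodic for }f_\lambda\}$. *)

(* Defs.v *)
From HB Require Import structures.
From mathcomp Require Import all_boot all_order all_algebra.
From mathcomp Require Import classical_sets reals.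

Set Implicit Arguments.
Unset Strict Implicit.
Unset Printing Implicit Defensive.

Import Order.TTheory GRing.Theory Num.Theory.
Local Open Scope ring_scope.

(* R is a model of the real numbers, in which absolute values take values. *)

Definition padic_abs (R : realType) (p : nat) (r : rat) : R :=
  if r == 0 then 0
  else p%:R ^ ((logn p `|denq r|)%:Z - (logn p `|numq r|)%:Z).

Definition nonarch_abs (R : realType) (K : fieldType) (v : K -> R) : Prop :=
  [/\ forall x, 0 <= v x,
      forall x, v x = 0 <-> x = 0,
      forall x y, v (x * y) = v x * v y
    & forall x y, v (x + y) <= Num.max (v x) (v y)].

Definition complete_abs (R : realType) (K : fieldType) (v : K -> R) : Prop :=
  forall u : nat -> K,
    (forall e : R, 0 < e -> exists N : nat, forall m n : nat,
       (N <= m)%N -> (N <= n)%N -> v (u m - u n) < e) ->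
    exists l : K, forall e : R, 0 < e -> exists N : nat, forall n : nat,
      (N <= n)%N -> v (u n - l) < e.

Record is_completion (R : realType) (K L : fieldType)
    (vK : K -> R) (vL : L -> R) (i : {rmorphism K -> L}) : Prop := {
  completion_abs : nonarch_abs vL;
  completion_ext : forall x : K, vL (i x) = vK x;
  completion_dense : forall (y : L) (e : R), 0 < e ->
    exists x : K, vL (y - i x) < e;
  completion_complete : complete_abs vL
}.

(* The tower Q -> Q_p -> \overline{Q_p} -> C_p: completion for the p-adic
   absolute value, algebraic closure with an absolute value extending that of
   Q_p, completion. Each step is determined up to isomorphism, and the extended
   absolute value is unique, so any two inhabitants have isometrically
   isomorphic top fields: quantifying over Cp_field R p is speaking of C_p. *)
Record Cp_field (R : realType) (p : nat) := {
  Qp : fieldType;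
  Qp_abs : Qp -> R;
  Qp_of_rat : {rmorphism rat -> Qp};
  Qp_completion : is_completion (padic_abs R p) Qp_abs Qp_of_rat;

  Qpbar : closedFieldType;
  Qpbar_abs : Qpbar -> R;
  Qpbar_of_Qp : {rmorphism Qp -> Qpbar};
  Qpbar_algebraic : forall x : Qpbar, algebraicOver Qpbar_of_Qp x;
  Qpbar_nonarch : nonarch_abs Qpbar_abs;
  Qpbar_ext : forall x : Qp, Qpbar_abs (Qpbar_of_Qp x) = Qp_abs x;

  Cp_sort :> fieldType;
  Cp_abs : Cp_sort -> R;
  Cp_of_Qpbar : {rmorphism Qpbar -> Cp_sort};
  Cp_completion : is_completion Qpbar_abs Cp_abs Cp_of_Qpbar
}.

(* P^1(K) = K \cup {oo}, with None the point at infinity. *)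
Definition P1 (K : fieldType) : Type := option K.

(* The point [a : b]; only meaningful when (a, b) != (0, 0). *)
Definition P1_point (K : fieldType) (a b : K) : P1 K :=
  if b == 0 then None else Some (a / b).

(* The map of P^1(K) induced by the rational function A / B (B != 0). A and B
   are first divided by their gcd, so that they never vanish simultaneously;
   the value at infinity is the ratio of the coefficients of degree
   m = max (deg A, deg B). *)
Definition P1_map (K : fieldType) (A B : {poly K}) (z : P1 K) : P1 K :=
  let A' := A %/ gcdp A B in
  let B' := B %/ gcdp A B in
  match z with
  | Some x => P1_point A'.[x] B'.[x]
  | None => let m := (maxn (size A') (size B')).-1 in P1_point A'`_m B'`_m
  end.

Definition f (K : fieldType) (p d : nat) (lambda : K) : P1 K -> P1 K :=
  P1_map ('X^d + lambda%:P) (p%:R *: 'X).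

Definition preperiodic (X : Type) (g : X -> X) (x : X) : Prop :=
  exists m n : nat, (0 < n)%N /\ iter (m + n) g x = iter m g x.

Definition T (K : fieldType) (p d : nat) (alpha : K) : set K :=
  [set lambda : K | preperiodic (f p d lambda) (Some alpha)]%classic.

(* Main.v *)
(** If [|z| > 1] and [|z|^d > |lambda|], then the ultrametric inequality gives
    [|f z| = p |z|^(d-1) > |z|], and [f z] satisfies the same two inequalities:
    the absolute value increases strictly along the orbit, so [z] is not
    preperiodic. If [|alpha| > 1 >= |lambda|], this applies to [alpha]. If
    [|alpha| <= 1] and [M = |alpha^d + lambda| >= 1], then [|lambda| <= M] and
    [|f alpha| = p M / |alpha| > M], so it applies to [f alpha]. *)
Require Import Defs.
From HB Require Import structures.
From mathcomp Require Import all_boot all_order all_algebra.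
From mathcomp Require Import classical_sets reals.

Set Implicit Arguments.
Unset Strict Implicit.
Unset Printing Implicit Defensive.

Import Order.TTheory GRing.Theory Num.Theory.
Local Open Scope ring_scope.

Section NonarchAbs.
Variables (R : realType) (K : fieldType) (v : K -> R).
Hypothesis hv : nonarch_abs v.

Lemma nonarch_abs_gt0 x : x != 0 -> 0 < v x.
Proof.
case: hv => v_ge0 v_eq0 _ _ x0; rewrite lt_def v_ge0 andbT.
by apply: contra x0 => /eqP /v_eq0 ->.
Qed.

Lemma nonarch_absM x y : v (x * y) = v x * v y.
Proof. by case: hv. Qed.

Lemma nonarch_abs1 : v 1 = 1.
Proof.
have v1_neq0 : v 1 != 0 by rewrite gt_eqF // nonarch_abs_gt0 ?oner_neq0.
by apply: (mulfI v1_neq0); rewrite -nonarch_absM !mulr1.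
Qed.

Lemma nonarch_absX x n : v (x ^+ n) = v x ^+ n.
Proof.
elim: n => [|n IHn]; first by rewrite !expr0 nonarch_abs1.
by rewrite !exprS nonarch_absM IHn.
Qed.

(** [v (-1)] is a positive real whose square is [v 1 = 1]. *)
Lemma nonarch_absN x : v (- x) = v x.
Proof.
suff vN1 : v (-1) = 1 by rewrite -mulN1r nonarch_absM vN1 mul1r.
have vN1_gt0 : 0 < v (-1) by rewrite nonarch_abs_gt0 // oppr_eq0 oner_neq0.
apply/eqP; rewrite -(@eqrXn2 _ 2) ?ltW //.
by rewrite -nonarch_absX sqrrN !expr1n nonarch_abs1.
Qed.

Lemma nonarch_abs_div x y : y != 0 -> v (x / y) = v x / v y.
Proof.
move=> y0; have vy0 : v y != 0 by rewrite gt_eqF ?nonarch_abs_gt0.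
by apply: (mulIf vy0); rewrite -nonarch_absM !divfK.
Qed.

Lemma nonarch_absD_dominant x y : v y < v x -> v (x + y) = v x.
Proof.
case: hv => _ _ _ v_add lt_yx; apply/eqP; rewrite eq_le; apply/andP; split.
  by apply: le_trans (v_add x y) _; rewrite ge_max lexx ltW.
(* Lower bound: [x = (x + y) - y] gives [v x <= max (v (x + y)) (v y)], and [v x <= v y] is
   excluded. *)
have := v_add (x + y) (- y); rewrite addrK nonarch_absN le_max.
by rewrite [v x <= v y]leNgt lt_yx orbF.
Qed.

End NonarchAbs.

(** The gcd divides [B], so it does not vanish at [x] either and cancels from the quotient. *)
Lemma P1_map_finite (K : fieldType) (A B : {poly K}) (x : K) :
  B.[x] != 0 -> P1_map A B (Some x) = Some (A.[x] / B.[x]).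
Proof.
move=> Bx0; rewrite /P1_map /P1_point.
set g := gcdp A B.
have eqA : A.[x] = (A %/ g).[x] * g.[x] by rewrite -hornerM divpK ?dvdp_gcdl.
have eqB : B.[x] = (B %/ g).[x] * g.[x] by rewrite -hornerM divpK ?dvdp_gcdr.
move: Bx0; rewrite eqA eqB mulf_eq0 negb_or => /andP[B'x0 gx0].
by rewrite (negPf B'x0) -mulf_div divff // mulr1.
Qed.

Lemma f_finite (K : fieldType) (p d : nat) (lambda z : K) :
  p%:R != 0 :> K -> z != 0 ->
  f p d lambda (Some z) = Some ((z ^+ d + lambda) / (p%:R * z)).
Proof.
by move=> p0 z0; rewrite /f P1_map_finite !hornerE // mulf_neq0.
Qed.

Lemma preperiodic_step (X : Type) (g : X -> X) (x : X) :
  preperiodic g x -> preperiodic g (g x).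
Proof. by case=> m [n [n0 E]]; exists m, n; rewrite -!iterSr !iterS E. Qed.

Section Escape.
Variables (R : realType) (K : fieldType) (v : K -> R) (p d : nat) (lambda : K).
Hypotheses (hv : nonarch_abs v) (p_neq0 : p%:R != 0 :> K) (vp_lt1 : v p%:R < 1).
Hypothesis hd : (2 <= d)%N.

(** A forward-invariant region; its second condition makes [z ^+ d] dominate the numerator of
    [f]. *)
Definition escaping (z : K) : bool := (1 < v z) && (v lambda < v z ^+ d).

Lemma escaping_neq0 z : escaping z -> z != 0.
Proof.
case/andP=> vz1 _; apply/eqP => z0; case: hv => _ /(_ z) [_ /(_ z0) vz0] _ _.
by move: vz1; rewrite vz0 ltr10.
Qed.

Lemma escaping_step z : escaping z ->
  exists w, [/\ f p d lambda (Some z) = Some w, escaping w & v z < v w].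
Proof.
move=> esc_z; have z0 := escaping_neq0 esc_z; case/andP: esc_z => vz1 lt_lz.
have vz_gt0 : 0 < v z := lt_trans ltr01 vz1.
have vp_gt0 := nonarch_abs_gt0 hv p_neq0.
exists ((z ^+ d + lambda) / (p%:R * z)); set w := _ / _.
have lt_zw : v z < v w.
  rewrite /w nonarch_abs_div ?mulf_neq0 // nonarch_absM //.
  rewrite nonarch_absD_dominant ?nonarch_absX //.
  (* After clearing the denominator, what remains is [|p| |z|^2 < |z|^2 <= |z|^d], where [d >= 2]
     enters. *)
  rewrite ltr_pdivlMr ?mulr_gt0 // mulrCA -expr2.
  apply: (@lt_le_trans _ _ (v z ^+ 2)); last by rewrite ler_weXn2l // ltW.
  by rewrite gtr_pMl // exprn_gt0.
split=> //; first exact: f_finite.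
rewrite /escaping (lt_trans vz1) //= (lt_trans lt_lz) //.
by rewrite ltrXn2r ?nnegrE -?lt0n ?ltW // (ltnW hd).
Qed.

(** The conditional inequality is strict except at [n = 0], so the induction can start there and
    still give strict growth for every positive [n]. *)
Lemma escaping_iter z n : escaping z ->
  exists w, [/\ iter n (f p d lambda) (Some z) = Some w, escaping w
    & v z < v w ?<= if (n == 0%N)].
Proof.
move=> esc_z; elim: n => [|n [w [E esc_w le_zw]]].
  by exists z; split=> //=; rewrite lexx.
have [w' [E' esc_w' lt_ww']] := escaping_step esc_w.
exists w'; split=> //=; first by rewrite E.
exact: le_lt_trans (lteifW le_zw) lt_ww'.
Qed.

Lemma escaping_not_preperiodic z :
  escaping z -> ~ preperiodic (f p d lambda) (Some z).
Proof.
move=> esc_z [m [n [n_gt0]]]; rewrite addnC iterD.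
(* The [m]-th iterate [w] is still escaping, so [n > 0] further steps strictly increase its absolute
   value and cannot return to [w]. *)
have [w [-> esc_w _]] := escaping_iter m esc_z.
have [w' [-> _ lt_ww']] := escaping_iter n esc_w.
by case=> E; move: lt_ww'; rewrite E gtn_eqF //= ltxx.
Qed.

End Escape.

Lemma padic_abs_prime (R : realType) (p : nat) :
  prime p -> padic_abs R p p%:R = p%:R^-1.
Proof.
move=> hp; rewrite /padic_abs pnatr_eq0 gtn_eqF ?prime_gt0 //.
have -> : (p%:R : rat) = (p%:Z)%:~R by [].
by rewrite numq_int denq_int /= logn1 logn_prime // eqxx sub0r exprN1.
Qed.

(** Ring morphisms fix the naturals, and each absolute value of the tower extends the preceding
    one. *)
Lemma Cp_abs_nat (R : realType) (p : nat) (C : Cp_field R p) (n : nat) :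
  Cp_abs (n%:R : C) = padic_abs R p n%:R.
Proof.
rewrite -(completion_ext (Qp_completion C)) rmorph_nat -Qpbar_ext rmorph_nat.
by rewrite -(completion_ext (Cp_completion C)) rmorph_nat.
Qed.

Theorem theorem5p1 (R : realType) (p d : nat) (hp : prime p) (hd : (2 <= d)%N)
    (C : Cp_field R p) (alpha lambda : C) (halpha : alpha != 0)
    (hlambda : T p d alpha lambda) :
  (Cp_abs alpha <= 1 -> Cp_abs (alpha ^+ d + lambda) < 1) /\
  (1 < Cp_abs alpha -> 1 < Cp_abs lambda).
Proof.
have hv := completion_abs (Cp_completion C).
have vp : Cp_abs (p%:R : C) = p%:R^-1 by rewrite Cp_abs_nat padic_abs_prime.
have vp_gt0 : 0 < Cp_abs (p%:R : C) by rewrite vp invr_gt0 ltr0n prime_gt0.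
have vp_lt1 : Cp_abs (p%:R : C) < 1.
  by rewrite vp invf_lt1 ?ltr1n ?ltr0n ?prime_gt1 ?prime_gt0.
have p_neq0 : p%:R != 0 :> C.
  apply/eqP => p0; case: (hv) => _ /(_ p%:R) [_ /(_ p0) vp0] _ _.
  by move: vp_gt0; rewrite vp0 ltxx.
have no_escape := escaping_not_preperiodic hv p_neq0 vp_lt1 hd.
split=> [valpha_le1 | valpha_gt1]; rewrite ltNge; apply/negP.
(* Since [|alpha| <= 1], [alpha] is not escaping; the contradiction comes from its image, which is
   preperiodic too. *)
- move=> M_ge1; have := preperiodic_step hlambda; rewrite f_finite //.
  apply: no_escape; move: M_ge1; set M := Cp_abs (alpha ^+ d + lambda) => M_ge1.
  have valpha_gt0 := nonarch_abs_gt0 hv halpha.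
  (* Write [lambda] as [(alpha ^+ d + lambda) - alpha ^+ d], where [|alpha|^d <= 1 <= M]. *)
  have vlambda_leM : Cp_abs lambda <= M.
    rewrite -(addKr (alpha ^+ d) lambda) addrC.
    case: (hv) => _ _ _ v_add; apply: le_trans (v_add _ _) _.
    rewrite ge_max lexx nonarch_absN // nonarch_absX //.
    by rewrite (le_trans _ M_ge1) // exprn_ile1 // ltW.
  (* [w] is the image of [alpha]; dividing by [|p alpha| <= |p| < 1] enlarges [M]. *)
  set w := _ / _; have lt_Mw : M < Cp_abs w.
    rewrite /w nonarch_abs_div ?mulf_neq0 // nonarch_absM //.
    rewrite ltr_pdivlMr ?mulr_gt0 // gtr_pMr ?(lt_le_trans ltr01) //.
    by rewrite (le_lt_trans _ vp_lt1) // ger_pMr.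
  have vw_gt1 := le_lt_trans M_ge1 lt_Mw.
  (* [|lambda| <= M < |w| <= |w|^d]. *)
  rewrite /escaping vw_gt1 (le_lt_trans vlambda_leM) // (lt_le_trans lt_Mw) //.
  by rewrite ler_eXnr ?ltW // ltnW.
- move=> vlambda_le1; apply: no_escape hlambda; rewrite /escaping valpha_gt1 /=.
  by rewrite (le_lt_trans vlambda_le1) // exprn_egt1 // -lt0n ltnW.
Qed.
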